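(* Let $\Theta\subseteq\mathbb R$ be an open interval containing $0$ and let $(F_\theta)_{\theta\in\Theta}$ be a family of continuous joint cdf's on $\mathbb R^2$ with common marginal cdf's $G$ and $H$ not depending on $\theta$, such that $F_0(x,y)=G(x)H(y)$ for all real $x,y$. Suppose that $F_\theta(x,y)$ is differentiable in $\theta$ at $\theta=0$ uniformly over $(x,y)\in\mathbb R^2$, that is, $$\sup_{(x,y)\in\mathbb R^2}\bigg|\frac{F_\theta(x,y)-F_0(x,y)}{\theta}-\Big(\frac{\partial F_\theta(x,y)}{\partial\theta}\Big|_{\theta=0}\Big)\bigg|\to0\quad\text{as }\theta\to0,$$ and that the function $\frac{\partial}{\partial\theta}F_\theta\big|_{\theta=0}$ on $\mathbb R^2$ is continuous and bounded. Then $$\frac1\theta\int_{\mathbb R^2}(F_\theta-F_0)\,d(F_\theta-F_0)\to0\quad\text{as }\theta\to0.$$ So, $\mathsf{ARE}_{T,S}(0)=1$ if, in addition, $$\liminf_{\theta\to0}\Big|\frac1\theta\int_{\mathbb R^2}(F_\theta-F_0)\,dF_0\Big|>0.$$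
   Context: Integrals against $dF_0$ and $d(F_\theta-F_0)$ are with respect to the probability measure with cdf $F_0$ and the signed measure which is the difference of the probability measures with cdf's $F_\theta$ and $F_0$. $\mathsf{ARE}_{T,S}(0)$ is the (two-sided Pitman) asymptotic relative efficiency, at the independence value $\theta=0$, of Kendall's correlation statistic $T$ relative to Spearman's correlation statistic $S$. With $(X,Y)$ having cdf $F_\theta$ under $\mathsf P_\theta$ (expectation $\mathsf E_\theta$, variance $\mathsf{Var}_\theta$), it is defined by $$\mathsf{ARE}_{T,S}(0):=\frac{\sigma_S^2(0)}{\sigma_T^2(0)}\lim_{\theta\to0}\frac{(\mu_T(\theta)-\mu_T(0))^2}{(\mu_S(\theta)-\mu_S(0))^2},$$ where $\mu_T(\theta)=4\,\mathsf E_\theta F_\theta(X,Y)-1$, $\mu_S(\theta)=12\,\mathsf E_\theta G(X)H(Y)-3$, $\sigma_T^2(\theta)=16\,\mathsf{Var}_\theta\big(2F_\theta(X,Y)-G(X)-H(Y)\big)$, and $$\sigma_S^2(\theta)=144\,\mathsf{Var}_\theta\Big((1-G(X))(1-H(Y))+\int_{\mathbb R}F_\theta(X,y)\,dH(y)+\int_{\mathbb R}F_\theta(x,Y)\,dG(x)\Big).$$ The assertion $\mathsf{ARE}_{T,S}(0)=1$ includes existence of the limit. *)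

(* Defs.v *)
From HB Require Import structures.
From mathcomp Require Import all_boot all_order all_algebra.
From mathcomp Require Import all_classical all_reals all_analysis.
From mathcomp Require Import measurable_realfun lra.

Set Implicit Arguments.
Unset Strict Implicit.
Unset Printing Implicit Defensive.

Import Order.TTheory GRing.Theory Num.Theory.
Import numFieldNormedType.Exports.

Local Open Scope classical_set_scope.
Local Open Scope ring_scope.

Section signed_integral.
Context d (T : measurableType d) (R : realType).

(* The integral of f against a signed measure nu is the difference of the
   integrals against its Jordan parts; by uniqueness of the Jordan decomposition
   it does not depend on the Hahn decomposition picked by cid. *)
Definition cintegral (nu : {charge set T -> \bar R}) (f : T -> R) : R :=
  let: exist _ exN := cid (Hahn_decomposition nu) in
  let: exist _ nuPN := cid exN in
  \int[jordan_pos nuPN]_x f x - \int[jordan_neg nuPN]_x f x.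

Definition diff_charge (P Q : probability T R) : {charge set T -> \bar R} :=
  cadd (charge_of_finite_measure P) (copp (charge_of_finite_measure Q)).

Lemma cintegral_diff_charge (P Q : probability T R) (f : T -> R) :
  P.-integrable setT (EFin \o f) -> Q.-integrable setT (EFin \o f) ->
  cintegral (diff_charge P Q) f = \int[P]_x f x - \int[Q]_x f x.
Proof.
move=> fP fQ; rewrite /cintegral.
case: cid => D exN; case: cid => N h /=.
have mD : measurable D by case: h => -[].
have mN : measurable N by case: h => _ [].
have posE A : measurable A ->
    jordan_pos h A = (P (A `&` D) - Q (A `&` D))%E.
  by move=> mA; rewrite jordan_posE cjordan_posE /crestr0 mem_set.
have negE A : measurable A ->
    jordan_neg h A = (Q (A `&` N) - P (A `&` N))%E.
  move=> mA; rewrite jordan_negE cjordan_negE /crestr0 mem_set//.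
  rewrite /crestr /= /cadd /copp /charge_of_finite_measure /=.
  have mAN : measurable (A `&` N) by exact: measurableI.
  by rewrite fin_num_oppeD ?fin_num_measure// oppeK addeC.
have le_int (mu m : {measure set T -> \bar R}) :
    (forall A, measurable A -> (mu A <= m A)%E) ->
    m.-integrable setT (EFin \o f) -> mu.-integrable setT (EFin \o f).
  move=> mum /integrableP[mf fm]; apply/integrableP; split => //.
  apply: le_lt_trans fm; apply: ge0_le_measure_integral => //.
  by apply/measurable_EFinP; apply: measurableT_comp => //; exact/measurable_EFinP.
have fpos : (jordan_pos h).-integrable setT (EFin \o f).
  apply: (le_int _ P) => // A mA; rewrite [leLHS]posE//.
  rewrite (@le_trans _ _ (P (A `&` D)))//.
    by rewrite leeBlDr ?fin_num_measure ?leeDl//; exact: measurableI.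
  by rewrite le_measure ?inE//; exact: measurableI.
have fneg : (jordan_neg h).-integrable setT (EFin \o f).
  apply: (le_int _ Q) => // A mA; rewrite [leLHS]negE//.
  rewrite (@le_trans _ _ (Q (A `&` N)))//.
    by rewrite leeBlDr ?fin_num_measure ?leeDl//; exact: measurableI.
  by rewrite le_measure ?inE//; exact: measurableI.
have swap (a b c e : \bar R) : a \is a fin_num -> b \is a fin_num ->
    c \is a fin_num -> e \is a fin_num ->
    (a - b = c - e -> c + b = a + e)%E.
  move: a b c e => [a| |] [b| |] [c| |] [e| |]//= _ _ _ _ [abce].
  by congr EFin; lra.
have : (\int[measure_add (jordan_pos h) Q]_x (EFin \o f) x =
        \int[measure_add P (jordan_neg h)]_x (EFin \o f) x)%E.
  apply: eq_measure_integral => A mA _.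
  rewrite [LHS]measure_addE [RHS]measure_addE.
  apply: swap; do ?exact: fin_num_measure.
  by have := jordan_decomp h mA; rewrite /cadd/= cscaleN1.
rewrite (integral_measure_add measurableT fpos fQ).
rewrite (integral_measure_add measurableT fP fneg).
move=> /(congr1 fine).
rewrite (fineD (integrable_fin_num measurableT fpos)
  (integrable_fin_num measurableT fQ)).
rewrite (fineD (integrable_fin_num measurableT fP)
  (integrable_fin_num measurableT fneg)).
move=> e; apply/eqP; rewrite subr_eq addrAC eq_sym subr_eq; apply/eqP/esym.
exact: e.
Qed.

End signed_integral.

Section correlation_statistics.
Context (R : realType).
Implicit Types (P : probability (R * R)%type R) (mu nu : probability R R).

Definition cdf1 mu (x : R) : R := fine (mu `]-oo, x]%classic).

Definition joint_cdf P (z : R * R) : R :=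
  fine (P (`]-oo, z.1]%classic `*` `]-oo, z.2]%classic)).

Definition has_marginal_cdfs P (G H : R -> R) : Prop :=
  (forall x, P (`]-oo, x]%classic `*` [set: R]) = (G x)%:E) /\
  (forall y, P ([set: R] `*` `]-oo, y]%classic) = (H y)%:E).

(* Below, P is the law of (X, Y), so that the identity of R * R plays the role of
   (X, Y); mu and nu are the marginal laws, with cdfs G and H. *)

Definition kendall_mean P : R := 4 * fine 'E_P[joint_cdf P] - 1.

Definition spearman_mean mu nu P : R :=
  12 * fine 'E_P[fun z => cdf1 mu z.1 * cdf1 nu z.2] - 3.

Definition kendall_variance mu nu P : R :=
  16 * fine 'V_P[fun z => 2 * joint_cdf P z - cdf1 mu z.1 - cdf1 nu z.2].

Definition spearman_variance mu nu P : R :=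
  144 * fine 'V_P[fun z => (1 - cdf1 mu z.1) * (1 - cdf1 nu z.2)
                           + \int[nu]_y joint_cdf P (z.1, y)
                           + \int[mu]_x joint_cdf P (x, z.2)].

Definition squared_mean_shift_ratio (P : R -> probability (R * R)%type R)
    mu nu (theta : R) : R :=
  (kendall_mean (P theta) - kendall_mean (P 0)) ^+ 2 /
  (spearman_mean mu nu (P theta) - spearman_mean mu nu (P 0)) ^+ 2.

(* Meaningful only when the limit exists. *)
Definition pitman_ARE (P : R -> probability (R * R)%type R) mu nu : R :=
  spearman_variance mu nu (P 0) / kendall_variance mu nu (P 0) *
  lim (squared_mean_shift_ratio P mu nu theta @[theta --> 0^']).

Definition dcdf0 (P : R -> probability (R * R)%type R) (z : R * R) : R :=
  derive1 (fun theta : R => joint_cdf (P theta) z) 0.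

End correlation_statistics.

(* Main.v *)
(* Let K(s, t) be the integral of F_s against P_t. By Fubini, the integral of F_r
   against P_s - P_t is the integral of the survival function of P_s minus that
   of P_t against P_r; with common continuous marginals, survival functions
   differ exactly as the cdfs do, so K(r, s) - K(r, t) = K(s, r) - K(t, r).

   Near 0, (F_t - F_0)/t is uniformly close to (F_s - F_0)/s for a fixed s, and
   the integral of F_s - F_0 against P_t - P_0 is, by this symmetry, that of
   F_t - F_0 against P_s - P_0, which tends to 0 because F_t -> F_0 uniformly:
   this is the first claim, with no appeal to weak convergence.

   Writing t a(t) = K(t, 0) - K(0, 0), the symmetry and the first claim make the
   mean shifts 4 t (2 a(t) + o(1)) for Kendall and 12 t a(t) for Spearman, whose
   squared ratio tends to 4/9. At independence the Hajek projection of Spearman's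
   statistic is half that of Kendall's plus a constant, so the variances have
   ratio (144/4)/16 = 9/4. *)
Require Import Defs.
From HB Require Import structures.
From mathcomp Require Import all_boot all_order all_algebra.
From mathcomp Require Import all_classical all_reals all_analysis.
From mathcomp Require Import measurable_realfun ess_sup_inf ring lra.

Import Order.TTheory GRing.Theory Num.Theory.
Import numFieldNormedType.Exports.

Local Open Scope classical_set_scope.
Local Open Scope ring_scope.

Set Implicit Arguments.
Unset Strict Implicit.

(** * Bounded integrands, Tonelli for sections, and null level sets *)

Section bounded_integrals.
Context d (T : measurableType d) (R : realType) (P : probability T R).
Implicit Types (f : T -> R) (M : R).

Lemma bounded_integrable f M : measurable_fun setT f ->
  (forall x, `|f x| <= M) -> P.-integrable setT (EFin \o f).
Proof.
move=> mf fM; apply: measurable_bounded_integrable => //.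
  by rewrite (le_lt_trans (probability_le1 _ _)) ?ltry.
exists M; split; first exact: num_real.
by move=> N MN x _ /=; rewrite (le_trans (fM x))// ltW.
Qed.

Lemma normr_Rintegral_le f M : measurable_fun setT f ->
  (forall x, `|f x| <= M) -> `|\int[P]_x f x| <= M.
Proof.
move=> mf fM; have fi := bounded_integrable mf fM.
apply: le_trans (le_normr_Rintegral _ fi) _ => //.
have -> : M = \int[P]_x (cst M) x.
  rewrite Rintegral_cst// -[LHS]mulr1; congr (_ * _).
  exact/esym/(congr1 fine (probability_setT P)).
have [M0 cM] : 0 <= M /\ forall x : T, `|cst M x| <= M.
  suff M0 : 0 <= M by split=> // x; rewrite ger0_norm.
  by rewrite (le_trans (normr_ge0 _) (fM point)).
apply: le_Rintegral => //.
- apply: (@bounded_integrable _ M); first exact: measurableT_comp.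
  by move=> x; rewrite normr_id.
- exact: (@bounded_integrable _ M).
Qed.

(** A bounded function is in L^oo, which a finite measure embeds in L^2; the variance identities
    used later ask for L^2 membership. *)
Lemma bounded_Lfun2 f M : measurable_fun setT f ->
  (forall x, `|f x| <= M) -> f \in Lfun P 2%:E.
Proof.
move=> mf fM; apply: (@Lfun_subset _ _ _ P 2%:E +oo%E) => //; rewrite ?lee1n ?leey//.
  exact: fin_num_measure.
apply/andP; split; rewrite inE//= /finite_norm unlock /Lnorm.
case: ifP => _; last by rewrite ltry.
by apply: (@le_lt_trans _ _ M%:E); rewrite ?ltry//; apply: ess_sup_ler => x;
  rewrite lee_fin.
Qed.

(** Both sides are the mass of [A] under the product of [P] and [Q], by Tonelli. *)
Lemma Rintegral_section (Q : probability T R) (A : set (T * T)) :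
  measurable A ->
  \int[P]_x fine (Q (xsection A x)) = \int[Q]_y fine (P (ysection A y)).
Proof.
move=> mA; congr fine.
rewrite (eq_integral (Q \o xsection A)); last first.
  by move=> x _ /=; rewrite fineK// fin_num_measure//; exact: measurable_xsection.
rewrite [RHS](eq_integral (P \o ysection A)); last first.
  by move=> x _ /=; rewrite fineK// fin_num_measure//; exact: measurable_ysection.
have := indic_fubini_tonelli P Q mA.
by rewrite indic_fubini_tonelli_FE// indic_fubini_tonelli_GE.
Qed.

Lemma measurable_fine_ysection (A : set (T * T)) :
  measurable A -> measurable_fun setT (fun y => fine (P (ysection A y))).
Proof.
move=> mA; apply/measurable_EFinP.
have := measurable_fun_ysection P mA; apply: eq_measurable_fun => y _ /=.
by rewrite fineK ?fin_num_measure//; exact: measurable_ysection.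
Qed.

(** For [t < x] the level set sits inside [X <= x] minus [X <= t], of mass [G x - G t], which
    continuity makes arbitrarily small. *)
Lemma level_set_null (X : T -> R) (G : R -> R) (x : R) :
  measurable_fun setT X -> continuous G ->
  (forall x, P (X @^-1` `]-oo, x]) = (G x)%:E) -> P (X @^-1` [set x]) = 0%E.
Proof.
move=> mX cG PG; apply/eqP; rewrite -measure_le0; apply/lee_addgt0Pr => e e0.
rewrite add0e.
have mI y : measurable (X @^-1` `]-oo, y]).
  by rewrite -[_ @^-1` _]setTI; exact: mX.
have [t [tx Ge]] : exists t, t < x /\ G x - G t < e.
  have /cvgrPdist_lt/(_ _ e0)[r /= r0 Hr] := cG x.
  exists (x - r / 2); split; first by rewrite gtrBl divr_gt0.
  apply: le_lt_trans (ler_norm _) _; apply: Hr => /=.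
  by rewrite opprB addrC subrK gtr0_norm ?divr_gt0// ltr_pdivrMr// ltr_pMr// ltr1n.
have sub : X @^-1` `]-oo, t] `<=` X @^-1` `]-oo, x].
  by move=> z /=; rewrite !in_itv/= => /le_trans -> //; exact: ltW.
apply: (@le_trans _ _ (P (X @^-1` `]-oo, x] `\` X @^-1` `]-oo, t]))).
  apply: le_measure; rewrite ?inE.
  - by rewrite -[_ @^-1` _]setTI; exact: mX.
  - exact: measurableD.
  - move=> z /= ->; split; first by rewrite in_itv/=.
    by rewrite in_itv/= leNgt tx.
rewrite measureD ?ltey_eq ?fin_num_measure// (setIidr sub).
by rewrite [X in (X - _)%E]PG [X in (_ - X)%E]PG lee_fin ltW.
Qed.

Lemma open_level_set (X : T -> R) (G : R -> R) (x : R) :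
  measurable_fun setT X -> continuous G ->
  (forall x, P (X @^-1` `]-oo, x]) = (G x)%:E) ->
  P (X @^-1` `]-oo, x[) = (G x)%:E.
Proof.
move=> mX cG PG; have mpre (B : set R) : measurable B -> measurable (X @^-1` B).
  by move=> mB; rewrite -[_ @^-1` _]setTI; exact: mX.
rewrite -PG -[LHS]adde0 -(level_set_null x mX cG PG) -measureU//; last 3 first.
- exact: mpre.
- exact: mpre.
- by apply/seteqP; split=> z /= []; rewrite in_itv/= => /[swap] ->; rewrite ltxx.
congr (P _); apply/seteqP; split=> z /=; rewrite !in_itv/=.
  by case=> [/ltW//|->].
by rewrite le_eqVlt => /predU1P[|]; [right|left].
Qed.

End bounded_integrals.

(** * Cdfs on the line *)

Section cdf1_theory.
Context (R : realType) (mu : probability R R).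

(** The identity as a random variable, so that the limits of [cdf] at infinity carry over to
    [cdf1]. *)
Let idRV : {RV mu >-> R} := mfun_Sub (mem_set (@measurable_id _ _ setT)).

Lemma cdf1E x : mu `]-oo, x]%classic = (cdf1 mu x)%:E.
Proof. by rewrite /cdf1 fineK ?fin_num_measure. Qed.

Lemma cdf1_cdf x : (cdf1 mu x)%:E = cdf idRV x.
Proof. by rewrite -cdf1E /cdf. Qed.

Lemma cdf1_ge0 x : 0 <= cdf1 mu x.
Proof. by rewrite /cdf1 fine_ge0. Qed.

Lemma cdf1_le1 x : cdf1 mu x <= 1.
Proof. by rewrite -lee_fin -cdf1E probability_le1. Qed.

Lemma cdf1_nondecreasing : {homo cdf1 mu : x y / x <= y}.
Proof.
move=> x y xy; rewrite -lee_fin -!cdf1E le_measure ?inE//.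
exact: subset_itvl.
Qed.

Lemma measurable_cdf1 : measurable_fun setT (cdf1 mu).
Proof. exact: nondecreasing_measurable cdf1_nondecreasing. Qed.

Lemma integrable_cdf1 : mu.-integrable setT (EFin \o cdf1 mu).
Proof.
apply: (@bounded_integrable _ _ _ _ _ 1) => [|x]; first exact: measurable_cdf1.
by rewrite ger0_norm ?cdf1_ge0 ?cdf1_le1.
Qed.

Lemma cdf1_lt p : 0 < p -> exists x, cdf1 mu x < p.
Proof.
move=> p0; have := cvg_cdfNy0 idRV.
move=> /(_ [set y | (y < p%:E)%E])[].
  by apply: open_nbhs_nbhs; split; [exact: open_ereal_lt_ereal|].
move=> M [_ H]; exists (M - 1).
have : M - 1 < M by rewrite gtrBl.
by move=> /H /=; rewrite -cdf1_cdf lte_fin.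
Qed.

Lemma cdf1_gt p : p < 1 -> exists x, p < cdf1 mu x.
Proof.
move=> p1; have := cvg_cdfy1 idRV.
move=> /(_ [set y | (p%:E < y)%E])[].
  by apply: open_nbhs_nbhs; split; [exact: open_ereal_gt_ereal|].
move=> M [_ H]; exists (M + 1).
have : M < M + 1 by rewrite ltrDl.
by move=> /H /=; rewrite -cdf1_cdf lte_fin.
Qed.

Lemma cdf1_surj p : continuous (cdf1 mu) -> 0 < p -> p < 1 ->
  exists x, cdf1 mu x = p.
Proof.
move=> cG p0 p1.
have [a /ltW Ga] := cdf1_lt p0; have [b /ltW Gb] := cdf1_gt p1.
have ab : Num.min a b <= Num.max a b by rewrite ge_min le_max !lexx.
have [||c _ <-] := @IVT R (cdf1 mu) _ _ p ab; last by exists c.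
  exact: continuous_subspaceT.
rewrite ge_min le_max; apply/andP; split; apply/orP.
  left; apply: le_trans Ga; apply: cdf1_nondecreasing.
  by rewrite ge_min lexx.
right; apply: (le_trans Gb); apply: cdf1_nondecreasing.
by rewrite le_max lexx orbT.
Qed.

(** Tonelli on the set [x <= y], one section in each variable: without atoms, [1 - cdf1 mu] and
    [cdf1 mu] have the same integral, and these integrals sum to 1. *)
Lemma Rintegral_cdf1 : continuous (cdf1 mu) -> \int[mu]_x cdf1 mu x = 2^-1.
Proof.
move=> cG.
pose A : set (R * R) := [set z | z.1 <= z.2].
have mA : measurable A.
  have mf : measurable_fun setT (fun z : R * R => z.1 <= z.2).
    exact: measurable_fun_ler.
  by rewrite -[A]setTI; exact: (mf measurableT [set true]).
have yA y : ysection A y = `]-oo, y]%classic.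
  by apply/seteqP; split=> x /=; rewrite /ysection /= in_itv inE.
have xA x : fine (mu (xsection A x)) = 1 - cdf1 mu x.
  have -> : xsection A x = ~` (id @^-1` `]-oo, x[%classic).
    apply/seteqP; split=> y; rewrite /xsection /= in_itv/= inE /A/= leNgt; by move/negP.
  rewrite probability_setC ?preimage_id//.
  have -> := @open_level_set _ _ _ mu id (cdf1 mu) x (@measurable_id _ _ setT) cG _.
    by [].
  by move=> y; rewrite preimage_id cdf1E.
have := Rintegral_section mu mu mA.
under eq_Rintegral do rewrite xA.
rewrite RintegralB//; last 2 first.
- by apply: (@bounded_integrable _ _ _ _ _ 1) => // x; rewrite normr1.
- exact: integrable_cdf1.
rewrite Rintegral_cst// [X in fine X](probability_setT mu)/= mulr1.
under [X in _ = X -> _]eq_Rintegral do rewrite yA.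
rewrite -/(cdf1 _ _).
lra.
Qed.

End cdf1_theory.

(** * Joint cdfs, survival functions and the Fubini symmetry *)

Section joint_cdf_theory.
Context (R : realType).
Implicit Types (P Q : probability (R * R)%type R) (G H : R -> R) (z : R * R).

(** The y-sections of this set are lower quadrants, whose masses are joint cdfs; its x-sections are
    closed upper quadrants, whose masses are survival functions. *)
Let below : set ((R * R) * (R * R)) :=
  [set zz | (zz.1.1 <= zz.2.1) && (zz.1.2 <= zz.2.2)].

Let measurable_below : measurable below.
Proof.
rewrite -[below]setTI.
have mf : measurable_fun setT (fun zz : (R * R) * (R * R) =>
    (zz.1.1 <= zz.2.1) && (zz.1.2 <= zz.2.2)).
  by apply: measurable_and; apply: measurable_fun_ler; exact: measurableT_comp.
exact: (mf measurableT [set true]).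
Qed.

Let ysection_below z : ysection below z = `]-oo, z.1]%classic `*` `]-oo, z.2]%classic.
Proof.
apply/seteqP; split=> -[x y]; rewrite /ysection/= !in_itv/= inE /below/=.
  by move/andP.
by move=> [-> ->].
Qed.

Lemma joint_cdfE P z :
  P (`]-oo, z.1]%classic `*` `]-oo, z.2]%classic) = (joint_cdf P z)%:E.
Proof. by rewrite /joint_cdf fineK ?fin_num_measure//; exact: measurableX. Qed.

Lemma measurable_joint_cdf P : measurable_fun setT (joint_cdf P).
Proof.
have := measurable_fine_ysection P measurable_below.
by apply: eq_measurable_fun => z _; rewrite ysection_below.
Qed.

Lemma joint_cdf_ge0 P z : 0 <= joint_cdf P z.
Proof. by rewrite /joint_cdf fine_ge0. Qed.

Lemma joint_cdf_le1 P z : joint_cdf P z <= 1.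
Proof.
by rewrite -lee_fin -joint_cdfE probability_le1//; exact: measurableX.
Qed.

Lemma integrable_joint_cdf P Q : Q.-integrable setT (EFin \o joint_cdf P).
Proof.
apply: (@bounded_integrable _ _ _ _ _ 1); first exact: measurable_joint_cdf.
by move=> z; rewrite ger0_norm ?joint_cdf_ge0 ?joint_cdf_le1.
Qed.

(** Inclusion-exclusion on the complement, a union of two open half-planes. Continuity of the
    marginals makes the boundary lines null, so open and closed half-planes and quadrants have equal
    mass. *)
Lemma closed_upper_quadrant P G H z : continuous G -> continuous H ->
  has_marginal_cdfs P G H ->
  P (xsection below z) = (1 - G z.1 - H z.2 + joint_cdf P z)%:E.
Proof.
move=> cG cH [PG PH].
have PG' x : P (fst @^-1` `]-oo, x]) = (G x)%:E by rewrite -PG setXT.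
have PH' x : P (snd @^-1` `]-oo, x]) = (H x)%:E by rewrite -PH setTX.
pose U := fst @^-1` `]-oo, z.1[ : set (R * R).
pose V := snd @^-1` `]-oo, z.2[ : set (R * R).
have mfst (B : set R) : measurable B -> measurable (fst @^-1` B : set (R * R)).
  by move=> mB; rewrite -[_ @^-1` _]setTI; exact: measurable_fst.
have msnd (B : set R) : measurable B -> measurable (snd @^-1` B : set (R * R)).
  by move=> mB; rewrite -[_ @^-1` _]setTI; exact: measurable_snd.
have mU : measurable U by exact: mfst.
have mV : measurable V by exact: msnd.
have PU : P U = (G z.1)%:E by exact: open_level_set.
have PV : P V = (H z.2)%:E by exact: open_level_set.
have PUV : P (U `&` V) = (joint_cdf P z)%:E.
  rewrite -joint_cdfE; set C := _ `*` _.
  have mC : measurable C by exact: measurableX.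
  have UVC : U `&` V `<=` C.
    by move=> w [/=]; rewrite /U /V /C/= !in_itv/= => /ltW ? /ltW.
  have N0 : P (C `\` (U `&` V)) = 0%E.
    have N1 : P (fst @^-1` [set z.1]) = 0%E by exact: (@level_set_null _ _ _ _ _ G).
    have N2 : P (snd @^-1` [set z.2]) = 0%E by exact: (@level_set_null _ _ _ _ _ H).
    (* What [C] has beyond the open quadrant lies on the two null lines through [z]. *)
    apply/eqP; rewrite -measure_le0 -[leRHS]adde0 -{1}N1 -N2.
    apply: le_trans (measureU2 _ _ _); [|exact: mfst|exact: msnd].
    apply: le_measure; rewrite ?inE.
    - by apply: measurableD => //; exact: measurableI.
    - by apply: measurableU; [exact: mfst|exact: msnd].
    - move=> [a b]; rewrite /C /U /V/= !in_itv/= => -[[+ +] nUV].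
      rewrite le_eqVlt => /predU1P[->|az]; first by left.
      rewrite le_eqVlt => /predU1P[->|bz]; first by right.
      by case: nUV.
  rewrite (measureDI P mC (measurableI _ _ mU mV)).
  by rewrite [X in (X + _)%E]N0 add0e (setIidr UVC).
have -> : xsection below z = ~` (U `|` V).
  apply/seteqP; split=> -[a b]; rewrite /xsection /below /U /V/= !in_itv/= inE/=.
    by move=> /andP[xa yb] []; rewrite ltNge ?xa ?yb.
  by move=> /not_orP[/negP + /negP]; rewrite -!leNgt => -> ->.
rewrite probability_setC; last exact: measurableU.
rewrite measureUfinr// ?ltey_eq ?fin_num_measure//.
rewrite [X in (_ - (X + _ - _))%E]PU [X in (_ - (_ + X - _))%E]PV.
rewrite [X in (_ - (_ + _ - X))%E]PUV.
rewrite -!EFinD -?EFinB; congr EFin; lra.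
Qed.

(** Tonelli turns each integral on the left into that of a survival function against [P]; the terms
    [1 - G - H] are common to [Q] and [Q'] and cancel in the difference. *)
Lemma Rintegral_joint_cdfB P Q Q' G H : continuous G -> continuous H ->
  has_marginal_cdfs Q G H -> has_marginal_cdfs Q' G H ->
  \int[Q]_z joint_cdf P z - \int[Q']_z joint_cdf P z =
  \int[P]_z joint_cdf Q z - \int[P]_z joint_cdf Q' z.
Proof.
move=> cG cH mQ mQ'.
have fubini Q0 : \int[Q0]_z joint_cdf P z =
    \int[P]_z fine (Q0 (xsection below z)).
  rewrite (Rintegral_section P Q0 measurable_below).
  by under [RHS]eq_Rintegral do rewrite ysection_below.
have ix Q0 :
    P.-integrable setT (EFin \o (fun z => fine (Q0 (xsection below z)))).
  apply: (@bounded_integrable _ _ _ _ _ 1).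
    apply/measurable_EFinP.
    have := measurable_fun_xsection Q0 measurable_below.
    apply: eq_measurable_fun => z _ /=.
    by rewrite fineK ?fin_num_measure//; exact: measurable_xsection.
  move=> z; have mz := measurable_xsection z measurable_below.
  rewrite ger0_norm ?fine_ge0// -lee_fin fineK ?fin_num_measure//.
  exact: probability_le1.
rewrite !fubini -!RintegralB//; try exact: integrable_joint_cdf.
apply: eq_Rintegral => z _.
rewrite (closed_upper_quadrant _ cG cH mQ) (closed_upper_quadrant _ cG cH mQ')/=.
lra.
Qed.

End joint_cdf_theory.

(** * Continuity of the marginals from that of the product *)

Section independent_marginals.
Context (R : realType) (P : probability (R * R)%type R) (mu nu : probability R R).
Hypothesis Fprod : forall x y, joint_cdf P (x, y) = cdf1 mu x * cdf1 nu y.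

Lemma continuous_cdf1_fst :
  continuous (joint_cdf P : R * R -> R) -> continuous (cdf1 mu).
Proof.
(* A section of the product at a point where the other factor is positive recovers the marginal by
   division. *)
move=> cF; have [y y0] := cdf1_gt nu (ltr01 : 0 < 1 :> R).
have -> : cdf1 mu = (fun x => joint_cdf P (x, y) * (cdf1 nu y)^-1).
  by apply/funext => x; rewrite Fprod mulfK// gt_eqF// (lt_trans _ y0).
move=> x; apply: cvgM; last exact: cvg_cst.
apply: (@continuous_comp _ _ _ (fun x : R => (x, y)) (joint_cdf P)); last exact: cF.
by apply: (@cvg_pair _ _ _ (nbhs x) (nbhs x) (nbhs y) _ _ _ id (cst y));
  [exact: cvg_id|exact: cvg_cst].
Qed.

Lemma continuous_cdf1_snd :
  continuous (joint_cdf P : R * R -> R) -> continuous (cdf1 nu).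
Proof.
move=> cF; have [x x0] := cdf1_gt mu (ltr01 : 0 < 1 :> R).
have -> : cdf1 nu = (fun y => joint_cdf P (x, y) * (cdf1 mu x)^-1).
  by apply/funext => y; rewrite Fprod mulrAC mulfV ?mul1r// gt_eqF// (lt_trans _ x0).
move=> y; apply: cvgM; last exact: cvg_cst.
apply: (@continuous_comp _ _ _ (fun y : R => (x, y)) (joint_cdf P)); last exact: cF.
by apply: (@cvg_pair _ _ _ (nbhs y) (nbhs x) (nbhs y) _ _ _ (cst x) id);
  [exact: cvg_cst|exact: cvg_id].
Qed.

End independent_marginals.

(** * First claim: the integral of the shift against itself *)

Section common_marginals.
Context (R : realType) (Theta : set R) (P : R -> probability (R * R)%type R).
Context (G H : R -> R).
Hypotheses (cG : continuous G) (cH : continuous H).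
Hypothesis Theta0 : Theta 0.
Hypothesis Fmarg : forall t, Theta t -> has_marginal_cdfs (P t) G H.

Local Notation F t := (joint_cdf (P t)).
Local Notation K s t := (\int[P t]_z F s z).

Lemma Rintegral_shift s t u :
  \int[P u]_z (F s z - F t z) = K s u - K t u.
Proof. by apply: RintegralB => //; exact: integrable_joint_cdf. Qed.

Lemma Rintegral_shift_swap r s t : Theta s -> Theta t ->
  K r s - K r t = K s r - K t r.
Proof. by move=> /Fmarg ms /Fmarg mt; exact: Rintegral_joint_cdfB ms mt. Qed.

Definition diff_quotient_gap (f : R * R -> R) (t e : R) :=
  forall z, `|(F t z - F 0 z) / t - f z| <= e.

(** The shift at [t] is compared with the shift at [s] rescaled by [t / s]. The remainder [D] is at
    most [2 * e * |t|] and is integrated twice, giving [4 * e]; the rescaled part, after the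
    symmetry, is a difference of two integrals of [F t - F 0] divided by [s], giving
    [2 * d / |s|]. *)
Lemma shift_self_integral_le f (e d s t : R) : Theta s -> Theta t ->
  s != 0 -> t != 0 -> diff_quotient_gap f s e -> diff_quotient_gap f t e ->
  (forall z, `|F t z - F 0 z| <= d) ->
  `|t^-1 * ((K t t - K 0 t) - (K t 0 - K 0 0))| <= 4 * e + 2 * d / `|s|.
Proof.
move=> Ts Tt s0 t0 gs gt Fd.
pose D z := (F t z - F 0 z) - t / s * (F s z - F 0 z).
have iF a u : (P u).-integrable setT (EFin \o F a) by exact: integrable_joint_cdf.
have iFB a b u : (P u).-integrable setT (EFin \o (fun z => F a z - F b z)).
  have := integrableB measurableT (iF a u) (iF b u).
  by apply: eq_integrable.
have mF a b : measurable_fun setT (fun z => F a z - F b z).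
  by apply: measurable_funB; exact: measurable_joint_cdf.
have DE u : \int[P u]_z D z = (K t u - K 0 u) - t / s * (K s u - K 0 u).
  rewrite -(Rintegral_shift t 0 u) -(Rintegral_shift s 0 u).
  rewrite -(RintegralZl (t / s) measurableT (iFB s 0 u)).
  apply: RintegralB => //; first exact: iFB.
  by have := integrableZl measurableT (t / s) (iFB s 0 u); exact: eq_integrable.
have Dle u : `|\int[P u]_z D z| <= 2 * e * `|t|.
  apply: normr_Rintegral_le.
    by apply: measurable_funB => //; exact: measurable_funM.
  move=> z; have -> : D z =
      t * (((F t z - F 0 z) / t - f z) - ((F s z - F 0 z) / s - f z)).
    by rewrite /D; field; rewrite s0 t0.
  rewrite normrM mulrC ler_wpM2r//.
  by rewrite (le_trans (ler_normB _ _))// mulr_natl mulr2n lerD.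
have Sle u : `|K t u - K 0 u| <= d.
  by rewrite -Rintegral_shift; exact: normr_Rintegral_le.
have swap1 := Rintegral_shift_swap s Tt Theta0.
have swap2 := Rintegral_shift_swap 0 Tt Theta0.
(* The symmetry exchanges the roles of [s] and [t] in the rescaled part, and the factor [t / s]
   loses its [t] against [t^-1]. *)
have -> : t^-1 * ((K t t - K 0 t) - (K t 0 - K 0 0)) =
   t^-1 * (\int[P t]_z D z - \int[P 0]_z D z) +
   s^-1 * ((K t s - K 0 s) - (K t 0 - K 0 0)).
  rewrite !DE -swap1 -[X in s^-1 * (_ - X)]swap2; field.
  by rewrite s0 t0.
apply: le_trans (ler_normD _ _) _; apply: lerD.
  rewrite normrM normfV ler_pdivrMl ?normr_gt0//.
  apply: le_trans (ler_normB _ _) _.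
  have := Dle t; have := Dle 0; lra.
rewrite normrM normfV mulrC ler_pM2r ?invr_gt0 ?normr_gt0//.
apply: le_trans (ler_normB _ _) _.
have := Sle s; have := Sle 0; lra.
Qed.

Lemma shift_self_integral_cvg0 (f : R * R -> R) (M : R) :
  (\forall t \near 0^', Theta t) ->
  (forall z, `|f z| <= M) ->
  (forall e, 0 < e -> \forall t \near 0^', diff_quotient_gap f t e) ->
  t^-1 * ((K t t - K 0 t) - (K t 0 - K 0 0)) @[t --> 0^'] --> 0.
Proof.
move=> nT fM gap; apply/cvgrPdist_le => e e0.
have e8 : 0 < e / 8 by rewrite divr_gt0.
have ns : \forall s \near (0 : R)^',
    [/\ Theta s, s != 0 & diff_quotient_gap f s (e / 8)].
  move: nT (nbhs_dnbhs_neq (0 : R)) (gap _ e8).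
  by apply: filterS3 => s ? ? ?; split.
have ps : ProperFilter (0 : R)^' by exact: Proper_dnbhs_numFieldType.
have [s [Ts s0 gs]] := @filter_ex _ _ ps _ ns.
have M0 : 0 <= M by rewrite (le_trans _ (fM (0, 0))).
(* With [s] fixed first, the term [4 * (e / 8)] is [e / 2]. The uniform bound on [F t - F 0] is
   [|t| * (M + e / 8)], and [|t| <= c] makes twice this over [|s|] at most [e / 2]. *)
pose c := e / 4 * `|s| / (M + e / 8).
have c0 : 0 < c.
  by rewrite /c !mulr_gt0 ?invr_gt0 ?ltr_wpDl ?normr_gt0.
near=> t; rewrite sub0r normrN.
have [Tt t0 gt] : [/\ Theta t, t != 0 & diff_quotient_gap f t (e / 8)] by near: t.
have tc : `|t| <= c by near: t; exact: dnbhs0_le.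
have Fd z : `|F t z - F 0 z| <= `|t| * (M + e / 8).
  rewrite -[_ - _](divfK t0) normrM mulrC ler_wpM2l//.
  have := ler_normD ((F t z - F 0 z) / t - f z) (f z); rewrite subrK.
  have := fM z; have := gt z; lra.
apply: le_trans (shift_self_integral_le Ts Tt s0 t0 gs gt Fd) _.
have : `|t| * (M + e / 8) / `|s| <= e / 4.
  by rewrite ler_pdivrMr ?normr_gt0// -ler_pdivlMr// ltr_wpDl.
rewrite -mulrA; lra.
Unshelve. all: by end_near. Qed.

End common_marginals.

(** * From suprema and lower limits to bounds near 0 *)

Lemma near_diff_quotient_gap (R : realType)
    (P : R -> probability (R * R)%type R) (f : R * R -> R) :
  ereal_sup [set (`|(joint_cdf (P t) z - joint_cdf (P 0) z) / t - f z|)%:E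
             | z in [set: R * R]] @[t --> (0 : R)^'] --> 0%E ->
  forall e, 0 < e -> \forall t \near (0 : R)^', diff_quotient_gap P f t e.
Proof.
move=> sup0 e e0.
have : \forall t \near (0 : R)^', (ereal_sup
    [set (`|(joint_cdf (P t) z - joint_cdf (P 0) z) / t - f z|)%:E
    | z in [set: R * R]] < e%:E)%E.
  apply: (sup0 [set y | (y < e%:E)%E]).
  by apply: open_nbhs_nbhs; split; [exact: open_ereal_lt_ereal|rewrite /= lte_fin].
apply: filterS => t supe z; rewrite -lee_fin; apply: le_trans (ltW supe).
by apply: ereal_sup_ubound; exists z.
Qed.

Lemma lime_inf_gt0 (R : realType) (f : R -> R) (a : R) :
  (0 < lime_inf (EFin \o f) a)%E ->
  exists2 c, 0 < c & \forall t \near a^', c <= f t.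
Proof.
rewrite lime_infE => /ereal_sup_gt[y [r]]; rewrite /= in_itv/= andbT => r0 <-.
rewrite oppe_gt0; set s := ereal_sup _ => s0.
(* [s] is the supremum of [- f] over a punctured ball; in the case [-oo] any positive [c] would
   serve. *)
have [c c0 sc] : exists2 c : R, 0 < c & (s <= (- c)%:E)%E.
  move: s0; case: s => [x| |]//=; rewrite ?lte_fin => x0.
    by exists (- x); rewrite ?oppr_gt0// opprK.
  by exists 1; rewrite ?leNye.
exists c => //; near=> t.
rewrite -lerN2 -lee_fin; apply: le_trans sc; apply: ereal_sup_ubound => /=.
by exists t => //; near: t; exact: dnbhs_ball.
Unshelve. all: by end_near. Qed.

(** * Variances at independence *)

Section independent_variances.
Context (R : realType) (P : probability (R * R)%type R) (mu nu : probability R R).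
Hypothesis Fprod : forall x y, joint_cdf P (x, y) = cdf1 mu x * cdf1 nu y.
Hypothesis cF : continuous (joint_cdf P : R * R -> R).
Hypothesis PG : forall x, P (`]-oo, x]%classic `*` [set: R]) = (cdf1 mu x)%:E.

Let cG : continuous (cdf1 mu) := continuous_cdf1_fst Fprod cF.
Let cH : continuous (cdf1 nu) := continuous_cdf1_snd Fprod cF.

Let K (z : R * R) := 2 * joint_cdf P z - cdf1 mu z.1 - cdf1 nu z.2.

Let mK : measurable_fun setT K.
Proof.
apply: measurable_funB; [apply: measurable_funB|].
- by apply: measurable_funM => //; exact: measurable_joint_cdf.
- by apply: (measurableT_comp (measurable_cdf1 mu)).
- by apply: (measurableT_comp (measurable_cdf1 nu)).
Qed.

Let bK z : `|K z| <= 4.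
Proof.
have := joint_cdf_ge0 P z; have := joint_cdf_le1 P z.
have := cdf1_ge0 mu z.1; have := cdf1_le1 mu z.1.
have := cdf1_ge0 nu z.2; have := cdf1_le1 nu z.2.
rewrite /K ler_norml; lra.
Qed.

(** The centred product form makes the sign of [K + 1/2] visible on each quadrant about the
    medians. *)
Let KE z : K z = 2 * (cdf1 mu z.1 - 2^-1) * (cdf1 nu z.2 - 2^-1) - 2^-1.
Proof. by case: z => x y; rewrite /K Fprod/=; field. Qed.

Let K2 : K \in Lfun P 2%:E.
Proof. exact: bounded_Lfun2 mK bK. Qed.

(** This permits division by Kendall's variance. Were it zero, Chebyshev would keep [K] almost
    surely within 1/8 of its mean, but [K] takes values too far apart with positive probability. *)
Lemma kendall_variable_variance_gt0 : (0 < 'V_P[K])%E.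
Proof.
rewrite lt_neqAle variance_ge0 andbT eq_sym; apply/eqP => V0.
have p4 : 0 < 4^-1 :> R by rewrite invr_gt0.
(* Levels 1/4 and 3/4 keep both centred factors at least 1/4 in size, whence the threshold 1/8 = 2 *
   (1/4)^2. *)
have [x Gx] := cdf1_surj cG p4 (ltac:(lra) : 4^-1 < 1 :> R).
have [y Hy] := cdf1_surj cH p4 (ltac:(lra) : 4^-1 < 1 :> R).
have [y' Hy'] := cdf1_surj cH (ltac:(lra) : 0 < 3 / 4 :> R)
  (ltac:(lra) : 3 / 4 < 1 :> R).
pose X : {RV P >-> R} := mfun_Sub (mem_set mK).
pose c := fine 'E_P[K].
pose N := [set z | 8^-1 <= `|K z - c|].
have N0 : P N = 0%E.
  apply/eqP; rewrite -measure_le0.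
  apply: le_trans (@chebyshev _ _ _ P X 8^-1 (ltac:(lra) : 0 < 8^-1 :> R)) _.
  by rewrite [X in (_ * X)%E]V0 mule0.
have mN : measurable N.
  have mf : measurable_fun setT (fun z => 8^-1 <= `|K z - c|).
    apply: measurable_fun_ler => //; apply: measurableT_comp => //.
    exact: measurable_funB.
  by rewrite -[N]setTI; exact: (mf measurableT [set true]).
pose U := `]-oo, x]%classic `*` [set: R] : set (R * R).
pose C t := `]-oo, x]%classic `*` `]-oo, t]%classic : set (R * R).
(* [K + 1/2] is at least 1/8 on [C y] and at most -1/8 on [U `\` C y'], two sets
   of probability 1/16: [N] contains one of them, whatever [c] is. *)
have mU : measurable U by exact: measurableX.
have mC t : measurable (C t) by exact: measurableX.
have [c_le|c_gt] := leP c (- 2^-1).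
  have : (P (C y) <= P N)%E.
    apply: le_measure; rewrite ?inE// => z [/=]; rewrite !in_itv/= => zx zy.
    have := cdf1_nondecreasing mu zx; have := cdf1_nondecreasing nu zy; rewrite Gx Hy => a b.
    rewrite /N/=; apply: le_trans (ler_norm _); rewrite KE.
    nra.
  rewrite [X in (X <= _)%E](joint_cdfE P (x, y)) Fprod Gx Hy N0 lee_fin; lra.
have : (P (U `\` C y') <= P N)%E.
  apply: le_measure; rewrite ?inE//; first exact: measurableD.
  move=> z [[/= + _]]; rewrite !in_itv/= => zx /not_andP[//|/negP].
  rewrite in_itv/= -ltNge => /ltW zy.
  have := cdf1_nondecreasing mu zx; have := cdf1_nondecreasing nu zy; rewrite Gx Hy' => a b.
  rewrite /N/= distrC; apply: le_trans (ler_norm _); rewrite KE.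
  nra.
rewrite measureD//; last by rewrite ltey_eq fin_num_measure.
rewrite (_ : U `&` C y' = C y').
  rewrite [X in (X - _)%E]PG [X in (_ - X)%E](joint_cdfE P (x, y')) Fprod Gx Hy'.
  rewrite N0 lee_fin; lra.
by apply/setIidPr => -[a b] [].
Qed.

Lemma spearman_varianceE : spearman_variance mu nu P = 36 * fine 'V_P[K].
Proof.
rewrite /spearman_variance.
(* Each inner integral is half a marginal cdf, since a continuous cdf has mean 1/2 under its own
   law; the sum collapses to [K / 2 + 1]. *)
rewrite [X in variance P X](_ : _ = ((2^-1 \o* K) \+ cst 1)%R); last first.
  apply/funext => z /=; rewrite KE.
  under eq_Rintegral do rewrite Fprod.
  under [X in _ + X]eq_Rintegral do rewrite Fprod.
  rewrite RintegralZl//; last exact: integrable_cdf1.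
  rewrite RintegralZr//; last exact: integrable_cdf1.
  by rewrite !Rintegral_cdf1//; field.
rewrite varianceD_cst_r; last by rewrite Lfun_scale// ler1n.
by rewrite varianceZ// fineM ?variance_fin_num//=; field.
Qed.

Lemma spearman_kendall_variance_ratio :
  spearman_variance mu nu P / kendall_variance mu nu P = 9 / 4.
Proof.
rewrite spearman_varianceE -[kendall_variance _ _ _]/(16 * fine 'V_P[K]).
have : 0 < fine 'V_P[K].
  by rewrite fine_gt0// kendall_variable_variance_gt0 ltey_eq variance_fin_num.
by move=> /lt0r_neq0 V0; field.
Qed.

End independent_variances.

(** * Mean shifts and the limit of their squared ratio *)

Section mean_shift.
Context (R : realType) (P : R -> probability (R * R)%type R) (mu nu : probability R R).

Local Notation F t := (joint_cdf (P t)).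
Local Notation K s t := (\int[P t]_z F s z).

Lemma kendall_meanE t : kendall_mean (P t) = 4 * K t t - 1.
Proof. by rewrite /kendall_mean unlock. Qed.

Lemma spearman_meanE t :
  (forall x y, F 0 (x, y) = cdf1 mu x * cdf1 nu y) ->
  spearman_mean mu nu (P t) = 12 * K 0 t - 3.
Proof.
move=> F0; rewrite /spearman_mean unlock; congr (12 * fine _ - 3).
by apply: eq_integral => -[x y] _; rewrite /= F0.
Qed.

(** Near 0 the ratio equals [((phi t / a t + 2) / 3) ^+ 2]. The lower bound [c] on [|a t|] both
    keeps the denominator nonzero and sends [phi t / a t] to 0. *)
Lemma squared_mean_shift_ratio_cvg (c : R) :
  (forall x y, F 0 (x, y) = cdf1 mu x * cdf1 nu y) ->
  (\forall t \near 0^', K 0 t - K 0 0 = K t 0 - K 0 0) ->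
  t^-1 * ((K t t - K 0 t) - (K t 0 - K 0 0)) @[t --> 0^'] --> 0 ->
  0 < c -> (\forall t \near 0^', c <= `|t^-1 * (K t 0 - K 0 0)|) ->
  squared_mean_shift_ratio P mu nu t @[t --> (0 : R)^'] --> (4 / 9 : R).
Proof.
move=> F0 Ksym phi0 c0 nc.
pose a t := t^-1 * (K t 0 - K 0 0).
pose phi t := t^-1 * ((K t t - K 0 t) - (K t 0 - K 0 0)).
have q0 : phi t / a t @[t --> 0^'] --> 0.
  apply/cvgrPdist_le => e e0.
  have /cvgrPdist_le/(_ (e * c) (mulr_gt0 e0 c0)) := phi0.
  move: nc; apply: filterS2 => t ct; rewrite !sub0r !normrN => pt.
  rewrite normrM normfV ler_pdivrMr; last exact: lt_le_trans ct.
  by apply: le_trans pt _; rewrite ler_pM2l.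
have : ((phi t / a t + 2) / 3) ^+ 2 @[t --> (0 : R)^'] --> (((0 + 2) / 3) ^+ 2 : R).
  have h : (phi t / a t + 2) / 3 @[t --> 0^'] --> ((0 + 2) / 3 : R).
    by apply: cvgM; [apply: cvgD; [exact: q0|exact: cvg_cst]|exact: cvg_cst].
  by rewrite expr2; under eq_fun do rewrite expr2; exact: cvgM.
rewrite (_ : ((0 + 2) / 3) ^+ 2 = 4 / 9); last by field.
apply: cvg_trans; apply: near_eq_cvg.
move: (nbhs_dnbhs_neq (0 : R)) Ksym nc; apply: filterS3 => t t0 Ks ct.
have at0 : a t != 0 by rewrite -normr_gt0 (lt_le_trans c0).
have Kt0 : K t 0 - K 0 0 = t * a t by rewrite /a mulrA mulfV// mul1r.
have Kp : (K t t - K 0 t) - (K t 0 - K 0 0) = t * phi t.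
  by rewrite /phi mulrA mulfV// mul1r.
rewrite /squared_mean_shift_ratio !kendall_meanE !spearman_meanE//.
(* Moving the integrand and moving the measure each contribute [t * a t], by [Ks]; hence the factor
   2. *)
have -> : 4 * K t t - 1 - (4 * K 0 0 - 1) = 4 * (t * phi t + 2 * (t * a t)).
  rewrite -Kp -Kt0; lra.
have -> : 12 * K 0 t - 3 - (12 * K 0 0 - 3) = 12 * (t * a t).
  rewrite -Kt0 -Ks; lra.
by field; rewrite at0 t0.
Qed.

End mean_shift.

Unset Implicit Arguments.
Set Strict Implicit.

Theorem proposition4p7 (R : realType) (Theta : set R)
  (P : R -> probability (R * R)%type R) (mu nu : probability R R)
  (Theta_open : open Theta) (Theta_itv : is_interval Theta) (Theta0 : Theta 0)
  (Fcont : forall theta, Theta theta ->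
     continuous (joint_cdf (P theta) : R * R -> R))
  (Fmarg : forall theta, Theta theta ->
     has_marginal_cdfs (P theta) (cdf1 mu) (cdf1 nu))
  (Findep : forall x y, joint_cdf (P 0) (x, y) = cdf1 mu x * cdf1 nu y)
  (Fderiv : forall z : R * R, derivable (fun theta => joint_cdf (P theta) z) 0 1)
  (Fderiv_unif :
     ereal_sup [set (`|(joint_cdf (P theta) z - joint_cdf (P 0) z) / theta
                       - dcdf0 P z|)%:E | z in [set: R * R]]
       @[theta --> (0 : R)^'] --> 0%E)
  (dF_cont : continuous (dcdf0 P : R * R -> R))
  (dF_bounded : bounded_fun (dcdf0 P)) :
  (theta^-1 * cintegral (diff_charge (P theta) (P 0))
                (fun z => joint_cdf (P theta) z - joint_cdf (P 0) z)
     @[theta --> (0 : R)^'] --> (0 : R))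
  /\
  ((0 < lime_inf (fun theta =>
          (`|theta^-1 * \int[P 0%R]_z (joint_cdf (P theta) z
                                       - joint_cdf (P 0) z)|%R)%:E) 0)%E ->
   cvg (squared_mean_shift_ratio P mu nu theta @[theta --> 0^']) /\
   pitman_ARE P mu nu = 1).
Proof.
have cF0 := Fcont 0 Theta0.
have cG := continuous_cdf1_fst Findep cF0.
have cH := continuous_cdf1_snd Findep cF0.
have nT : \forall t \near (0 : R)^', Theta t.
  by apply: nbhs_dnbhs; exact: open_nbhs_nbhs.
have gap := near_diff_quotient_gap Fderiv_unif.
have [M fM] : exists M, forall z, `|dcdf0 P z| <= M.
  have [M [_ HM]] := dF_bounded; exists (M + 1) => z.
  by apply: HM => //; rewrite ltrDl.
have int_shift t u := Rintegral_shift P t 0 u.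
have phi0 := shift_self_integral_cvg0 cG cH Theta0 Fmarg nT fM gap.
split.
  (* The signed integral splits into integrals against [P t] and [P 0], which gives the expression
     of [phi0] for every [t]. *)
  apply: cvg_trans phi0; apply: near_eq_cvg; apply: nearW => t.
  have i u : (P u).-integrable setT
      (EFin \o (fun z => joint_cdf (P t) z - joint_cdf (P 0) z)).
    apply: eq_integrable (integrableB measurableT
      (integrable_joint_cdf (P t) (P u)) (integrable_joint_cdf (P 0) (P u))) => //.
  by rewrite cintegral_diff_charge// !int_shift.
move=> liminf_gt0.
have [c c0 nc] := lime_inf_gt0 liminf_gt0.
have Ksym : \forall t \near (0 : R)^',
    \int[P t]_z joint_cdf (P 0) z - \int[P 0]_z joint_cdf (P 0) z =
    \int[P 0]_z joint_cdf (P t) z - \int[P 0]_z joint_cdf (P 0) z.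
  by apply: filterS nT => t Tt; exact: (Rintegral_shift_swap cG cH Fmarg).
have rcvg : squared_mean_shift_ratio P mu nu t @[t --> (0 : R)^'] --> (4 / 9 : R).
  apply: (squared_mean_shift_ratio_cvg Findep Ksym phi0 c0).
  by apply: filterS nc => t /=; rewrite int_shift.
split; first by apply/cvg_ex; exists (4 / 9).
(* The variance ratio 9/4 and the limit 4/9 are reciprocal. *)
rewrite /pitman_ARE (spearman_kendall_variance_ratio Findep cF0 (Fmarg 0 Theta0).1).
by rewrite (cvg_lim _ rcvg)//; field.
Qed.
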